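(* For every positive integer $n$, the inspection number of the triangular grid graph $T_n$ satisfies \[ \frac{n}{\sqrt{2}}<\mathrm{In}(T_n)\le \left\lceil\frac{3n}{4}\right\rceil+2 . \]
   Context: The triangular grid graph $T_n$ has vertex set $\{(v_1,v_2)\in\mathbb{Z}_{\ge 0}^2 : v_1+v_2\le n\}$, and two vertices are adjacent iff they are of the form $(a,b),(a+1,b)$, or $(a,b),(a,b+1)$, or $(a+1,b),(a,b+1)$. Zero-Visibility $k$-Search game on a graph $G$: an invisible intruder occupies a vertex; in each turn the searcher examines a set of at most $k$ vertices, and the intruder is caught if it is on an examined vertex; between consecutive examinations the intruder may stay at its vertex or move to an adjacent vertex, and the searcher never has any information about the intruder's position. A winning strategy is a finite sequence $S_1,\dots,S_T$ of vertex sets with $|S_i|\le k$ such that there is no sequence of vertices $x_1,\dots,x_T$ with $x_i\notin S_i$ for all $i$ and, for each $i<T$, $x_{i+1}=x_i$ or $x_{i+1}$ adjacent to $x_i$ (i.e. the intruder is caught no matter how it moves). The inspection number $\mathrm{In}(G)$ is the minimum $k$ for which a winning strategy exists. *)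

(* Defs.v *)
From HB Require Import structures.
From mathcomp Require Import all_boot all_order all_algebra.
From mathcomp Require Import boolp reals.
Set Implicit Arguments.
Unset Strict Implicit.
Unset Printing Implicit Defensive.

Record sgraph := SGraph {
  vertex :> finType;
  adj : rel vertex;
  adj_sym : symmetric adj;
  adj_irr : irreflexive adj }.

(* x is a walk of the intruder (staying put allowed) that is never on an
   examined vertex. *)
Definition evades (G : sgraph) (T : nat) (S : 'I_T -> {set G})
    (x : 'I_T -> G) : Prop :=
  (forall i, x i \notin S i) /\
  (forall i j : 'I_T, j = i.+1 :> nat -> x j = x i \/ adj (x i) (x j)).

Definition winning_strategy (G : sgraph) (k T : nat)
    (S : 'I_T -> {set G}) : Prop :=
  (forall i, #|S i| <= k) /\ ~ (exists x, evades S x).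

Definition searchable (G : sgraph) (k : nat) : Prop :=
  exists (T : nat) (S : 'I_T -> {set G}), winning_strategy k S.

Lemma searchable_card (G : sgraph) : searchable G #|G|.
Proof.
exists 1, (fun=> setT); split=> [i|[x [/(_ ord0)]]]; first by rewrite cardsT.
by rewrite inE.
Qed.

Lemma searchable_ex (G : sgraph) : exists k, `[< searchable G k >].
Proof. by exists #|G|; apply/asboolP/searchable_card. Qed.

Definition inspection_number (G : sgraph) : nat := ex_minn (searchable_ex G).

Section TriangularGrid.
Variable n : nat.

(* A coordinate of a vertex is at most n, hence the ordinals. *)
Definition tgrid_vertex : finType :=
  {v : 'I_n.+1 * 'I_n.+1 | v.1 + v.2 <= n}.

Definition tgrid_edge (u v : tgrid_vertex) : bool :=
  let: (u1, u2) := (val (val u).1, val (val u).2) in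
  let: (v1, v2) := (val (val v).1, val (val v).2) in
  [|| (v1 == u1.+1) && (v2 == u2),
      (v1 == u1) && (v2 == u2.+1)
    | (u1 == v1.+1) && (v2 == u2.+1)].

Definition tgrid_adj : rel tgrid_vertex :=
  fun u v => tgrid_edge u v || tgrid_edge v u.

Lemma tgrid_adj_sym : symmetric tgrid_adj.
Proof. by move=> u v; rewrite /tgrid_adj orbC. Qed.

Lemma tgrid_adj_irr : irreflexive tgrid_adj.
Proof.
by move=> u; rewrite /tgrid_adj /tgrid_edge /= orbb !(ltn_eqF (leqnn _)) !andbF.
Qed.

Definition tgrid : sgraph := SGraph tgrid_adj_sym tgrid_adj_irr.

End TriangularGrid.

(* Main.v *)
(** Between two inspections, the vertices are split into the set [Y] of the
    contaminated vertices, the set [F] of their clean neighbours, and the rest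
    [X], which is what survives the next move of the intruder.

    Lower bound: two sets [X] and [Y] without edges between them satisfy
    [min(#|X|, #|Y|) <= 'C(#|F|, 2)] (count along the columns, starting from the
    first column free of [F]).  Hence with [2 k^2 <= n^2] the surviving clean
    set never has more than ['C(k + 1, 2)] elements: if [#|F| >= k] the [k]
    inspections do not compensate the loss, and otherwise [X] or [Y] is small,
    the latter being excluded by counting.

    Upper bound: let [m = n %/ 4] and [j = n - m].  Clean the corner
    [x + y < j] diagonal by diagonal.  Then let its diagonal front retreat
    freely by one step per move and spend the inspections on the bottom rows,
    which get completed up to the opposite side: after [2 m] moves the rows
    [y < m] are clean.  The remaining rows have at most [j + 1] vertices and are
    swept one after the other. *)
Require Import Defs.
From HB Require Import structures.
From mathcomp Require Import all_boot all_order all_algebra.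
From mathcomp Require Import boolp reals.
From mathcomp Require Import zify lra.
Import Order.TTheory GRing.Theory Num.Theory.
Set Implicit Arguments.
Unset Strict Implicit.
Unset Printing Implicit Defensive.

(** * Contaminated sets and cleanable sets on an arbitrary graph *)

Section Game.
Variable G : sgraph.
Implicit Types (S : nat -> {set G}) (P B Q : {set G}).

Definition nbhd P : {set G} := [set v | [exists u in P, (u == v) || adj u v]].

(* The vertices the intruder can occupy just before the inspection of [S t]. *)
Fixpoint dirty S t : {set G} :=
  if t is t'.+1 then nbhd (dirty S t' :\: S t') else setT.

Lemma eq_dirty S S' t :
  (forall i, i < t -> S i = S' i) -> dirty S t = dirty S' t.
Proof.
elim: t => //= t IH eqS; rewrite eqS // IH // => i lt_it.
by apply: eqS; apply: ltnW.
Qed.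

Lemma dirty_walk S t v : v \in dirty S t ->
  exists x : nat -> G, [/\ x t = v, forall i, i < t -> x i \notin S i
    & forall i, i < t -> x i.+1 = x i \/ adj (x i) (x i.+1)].
Proof.
elim: t v => [|t IH] v /=; first by exists (fun=> v).
rewrite inE => /existsP[u /andP[]]; rewrite inE => /andP[uS /IH[x [xt xS xw]]] uv.
exists (fun i => if i <= t then x i else v); split; first by rewrite ltnn.
  move=> i; rewrite ltnS => le_it; rewrite le_it.
  by move: le_it; rewrite leq_eqVlt => /orP[/eqP->|/xS//]; rewrite xt.
move=> i; rewrite ltnS => le_it; rewrite le_it.
move: le_it; rewrite leq_eqVlt => /orP[/eqP->|lt_it]; last by rewrite lt_it; apply: xw.
by rewrite ltnn xt; case/orP: uv => [/eqP->|]; [left|right].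
Qed.

Lemma evades_dirty T (S : 'I_T -> {set G}) S' (x : 'I_T -> G) (i : 'I_T) :
  (forall j : 'I_T, S' j = S j) -> evades S x -> x i \in dirty S' i.
Proof.
move=> eqS [xS xw]; case: i => i; elim: i => [|i IH] lt_iT /=; first by rewrite inE.
have lt_iT' := ltnW lt_iT; rewrite inE; apply/existsP; exists (x (Ordinal lt_iT')).
rewrite inE IH andbT (eqS (Ordinal lt_iT')) xS /=.
have /= := xw (Ordinal lt_iT') (Ordinal lt_iT) erefl.
by case=> [->|->]; rewrite ?eqxx ?orbT.
Qed.

Lemma searchableP k : searchable G k <->
  exists T S, (forall i, #|S i| <= k) /\ dirty S T = set0.
Proof.
split=> [[T [S [Sk noev]]]|[T [S [Sk S0]]]].
  pose S' i := if insub i is Some i' then S i' else set0.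
  exists T, S'; split=> [i|]; first by rewrite /S'; case: insubP => // _; rewrite cards0.
  apply/setP=> v; rewrite inE; apply/negP=> /dirty_walk[x [_ xS xw]].
  apply: noev; exists (fun i => x i); split=> [i|i j ji].
    by have := xS i (ltn_ord i); rewrite /S' valK.
  by rewrite ji; apply: xw.
(* [dirty S T] describes the position just before inspection [T], so the walk needs the index [T]
   and the strategy [T.+1] inspections. *)
exists T.+1, (fun i => S i); split=> // -[x ev].
by have := evades_dirty ord_max (fun=> erefl) ev; rewrite /= S0 inE.
Qed.

Definition cleanable k P :=
  exists T S, (forall i, #|S i| <= k) /\ [disjoint P & dirty S T].

Lemma cleanable0 k : cleanable k set0.
Proof.
exists 0, (fun=> set0); split=> [i|]; first by rewrite cards0.
by rewrite -setI_eq0 set0I.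
Qed.

Lemma cleanableS k P Q : Q \subset P -> cleanable k P -> cleanable k Q.
Proof.
move=> sQP [T [S [Sk dP]]]; exists T, S; split=> //.
exact: disjointWl dP.
Qed.

(** [B] contains the closed neighbourhood of [Q]. While [P] is clean, inspecting [B :\: P] rules out
    all of [B], so the next move cannot lead into [Q]. *)
Lemma cleanable_step k P B Q : cleanable k P -> #|B :\: P| <= k ->
  (forall u v, v \in Q -> (u == v) || adj u v -> u \in B) -> cleanable k Q.
Proof.
move=> [T [S [Sk dP]]] Bk QB.
pose S' i := if i < T then S i else B :\: P.
exists T.+1, S'; split=> [i|]; first by rewrite /S'; case: ifP.
rewrite /= (@eq_dirty S' S) => [|i lt_iT]; last by rewrite /S' lt_iT.
rewrite disjoint_subset; apply/subsetP=> v vQ; rewrite !inE.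
apply/existsPn=> u; apply/negP=> /andP[]; rewrite /S' ltnn !inE => /andP[uS uD] uv.
move: uS; rewrite (QB u v) // andbT negbK => uP.
by have := disjointFr dP uP; rewrite uD.
Qed.

Lemma cleanableT k : cleanable k setT -> searchable G k.
Proof.
case=> T [S [Sk dT]]; apply/searchableP; exists T, S; split=> //.
by apply/setP=> v; rewrite inE (disjointFr dT).
Qed.

End Game.

(** * Grid coordinates and counting the cells to inspect *)

Lemma card_le_range (T : finType) (A : {set T}) (f : T -> nat) lo k :
  {in A &, injective f} -> (forall x, x \in A -> lo <= f x < lo + k) -> #|A| <= k.
Proof.
move=> f_inj f_rng; rewrite cardE -(size_map f) -[k in leqRHS](size_iota lo).
apply: uniq_leq_size => [|_ /mapP[x xA ->]]; last first.
  by rewrite mem_iota f_rng // -mem_enum.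
by rewrite map_inj_in_uniq ?enum_uniq // => x y; rewrite !mem_enum; apply: f_inj.
Qed.

Section Coordinates.
Variable n : nat.
Implicit Types (u v : tgrid n) (c y : nat).

Definition vx v : nat := val (val v).1.
Definition vy v : nat := val (val v).2.

Lemma vxy_le v : vx v + vy v <= n.
Proof. exact: (valP v). Qed.

Lemma vxy_inj u v : vx u = vx v -> vy u = vy v -> u = v.
Proof.
rewrite /vx /vy => ux uy; apply/val_inj.
by case: (val u) (val v) ux uy => [a b] [c d] /= /val_inj-> /val_inj->.
Qed.

Lemma tgrid_adjE u v : adj u v =
  [|| (vx v == (vx u).+1) && (vy v == vy u), (vx v == vx u) && (vy v == (vy u).+1),
      (vx u == (vx v).+1) && (vy v == (vy u).+1),
      (vx u == (vx v).+1) && (vy u == vy v), (vx u == vx v) && (vy u == (vy v).+1)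
    | (vx v == (vx u).+1) && (vy u == (vy v).+1)].
Proof. by rewrite /= /tgrid_adj /tgrid_edge -/(vx u) -/(vx v) -/(vy u) -/(vy v) -!orbA. Qed.

Definition vtx c y (cy : c + y <= n) : tgrid n :=
  @exist _ (fun v : 'I_n.+1 * 'I_n.+1 => v.1 + v.2 <= n)
    (Ordinal (leq_ltn_trans (leq_addr y c) (leq_ltn_trans cy (ltnSn n))),
     Ordinal (leq_ltn_trans (leq_addl c y) (leq_ltn_trans cy (ltnSn n)))) cy.

(** The inspected cells are counted by an injection [f] into an interval of [k] integers; in the
    uses below [f] lists them diagonal by diagonal or row by row. *)
Lemma tgrid_step k (P B Q : nat -> nat -> bool) (f : nat -> nat -> nat) lo :
  cleanable k [set v : tgrid n | P (vx v) (vy v)] ->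
  (forall u v, Q (vx v) (vy v) -> (u == v) || adj u v -> B (vx u) (vy u)) ->
  (forall v, B (vx v) (vy v) -> ~~ P (vx v) (vy v) ->
     lo <= f (vx v) (vy v) < lo + k) ->
  (forall u v, B (vx u) (vy u) -> ~~ P (vx u) (vy u) ->
     B (vx v) (vy v) -> ~~ P (vx v) (vy v) ->
     f (vx u) (vy u) = f (vx v) (vy v) -> vx u = vx v /\ vy u = vy v) ->
  cleanable k [set v : tgrid n | Q (vx v) (vy v)].
Proof.
move=> cP QB f_rng f_inj.
apply: (cleanable_step (B := [set v : tgrid n | B (vx v) (vy v)]) cP); last first.
  by move=> u v; rewrite !inE; apply: QB.
apply: (@card_le_range _ _ (fun v => f (vx v) (vy v)) lo) => [u v|v].
  rewrite !inE => /andP[uP uB] /andP[vP vB] eq_f.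
  by have [] := f_inj u v uB uP vB vP eq_f; apply: vxy_inj.
by rewrite !inE => /andP[vP vB]; apply: f_rng.
Qed.

End Coordinates.

(** * Inequalities between sums of column sizes *)

Lemma bin2D p q : 'C(p + q, 2) = 'C(p, 2) + 'C(q, 2) + p * q.
Proof.
elim: q => [|q IH]; first by rewrite addn0 muln0 addn0 bin0n addn0.
by rewrite addnS !binS !bin1 IH; lia.
Qed.

Lemma leq_bin2 p q : p <= q -> 'C(p, 2) <= 'C(q, 2).
Proof. by move=> /subnKC<-; rewrite bin2D -addnA leq_addr. Qed.

(** Let [F] be the sum of [f] over the columns after the first. Inductively [y 0 <= y 1 + f 1 <= F],
    while ['C(f 0 + F, 2)] exceeds ['C(F, 2)] by at least [F] because [f 0 > 0]. *)
Lemma sum_before (y f : nat -> nat) c0 : y c0 = 0 -> f c0 = 0 ->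
  (forall c, c < c0 -> y c <= y c.+1 + f c.+1) ->
  (forall c, c < c0 -> 0 < f c) ->
  \sum_(c < c0) y c <= 'C(\sum_(c < c0) f c, 2).
Proof.
move=> y0 f0 yf f_gt0.
suff /andP[] : (\sum_(c < c0) y c <= 'C(\sum_(c < c0) f c, 2)) &&
  (y 0 + f 0 <= \sum_(c < c0) f c) by [].
elim: c0 y f y0 f0 yf f_gt0 => [|c0 IH] y f y0 f0 yf f_gt0.
  by rewrite !big_ord0 y0 f0.
have step Y F : (Y <= 'C(F, 2)) && (y 1 + f 1 <= F) ->
    (y 0 + Y <= 'C(f 0 + F, 2)) && (y 0 + f 0 <= f 0 + F).
  have := yf 0 isT; have := f_gt0 0 isT; rewrite bin2D.
  by case: (f 0) => // f1 _ y0F /andP[YF y1F]; rewrite mulSn; lia.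
rewrite !big_ord_recl; apply: step.
exact: (IH (fun c => y c.+1) (fun c => f c.+1) y0 f0
  (fun c cc => yf c.+1 cc) (fun c cc => f_gt0 c.+1 cc)).
Qed.

Lemma sum_after (y f : nat -> nat) N : y 0 = 0 ->
  (forall c, c < N -> y c.+1 = 0 \/ y c.+1 < y c + f c) ->
  \sum_(c < N.+1) y c <= 'C(\sum_(c < N) f c, 2).
Proof.
move=> y0 yf.
(* The term ['C(y N, 2)] is a potential that pays for the next column: a nonzero next value [y']
   satisfies [y' + 'C(y', 2) = 'C(y'.+1, 2) <= 'C(y N + f N, 2)]. *)
have /andP[] : (y N <= \sum_(c < N) f c) &&
  (\sum_(c < N.+1) y c + 'C(y N, 2) <= 'C(\sum_(c < N) f c, 2)); last by lia.
elim: N yf => [|N IH] yf; first by rewrite big_ord1 big_ord0 y0.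
have /andP[] := IH (fun c cN => yf c (ltnW cN)).
rewrite [\sum_(c < N.+2) _]big_ord_recr [\sum_(c < N.+1) f c]big_ord_recr /=.
move: (\sum_(c < N.+1) y c) (\sum_(c < N) f c) => Y F yF YF.
rewrite bin2D.
case: (yf N (ltnSn N)) => [->|lt_y]; first by rewrite bin0n; lia.
have : 'C((y N.+1).+1, 2) <= 'C(y N + f N, 2) by apply: leq_bin2.
have : y N * f N <= F * f N by rewrite leq_mul2r yF orbT.
by rewrite binS bin1 bin2D; lia.
Qed.

(** The union of a nonempty finite set of integers with its translate by one has at least one more
    element than the set. *)
Lemma sum_shift_up (p z : pred nat) h :
  (forall y, y < h -> p y -> z y && z y.+1) ->
  \sum_(y < h) p y = 0 \/ \sum_(y < h) p y < \sum_(y < h.+1) z y.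
Proof.
elim: h => [|h IH] pz; first by left; rewrite big_ord0.
have := IH (fun y yh => pz y (ltnW yh)).
rewrite [\sum_(y < h.+1) p y]big_ord_recr [\sum_(y < h.+2) z y]big_ord_recr /=.
have := pz h (ltnSn h); case: (p h) => [/(_ isT)/andP[zh zh1]|_] IHh; last first.
  by case: IHh; lia.
right; rewrite zh1; case: IHh => [->|]; last by lia.
by rewrite big_ord_recr /= zh; lia.
Qed.

(** The gap [g] gives an injection of [p] into [z]: elements below [g] stay, those above move down
    by one. *)
Lemma sum_shift_down (p z : pred nat) h g : g <= h -> ~~ p g ->
  (forall y, y < h -> p y -> z y) -> (forall y, y < h -> p y.+1 -> z y) ->
  \sum_(y < h.+1) p y <= \sum_(y < h) z y.
Proof.
move=> gh pg; elim: h gh => [|h IH] gh pz pz1.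
  by move: gh pg; rewrite leqn0 => /eqP-> /negPf p0; rewrite big_ord1 big_ord0 p0.
rewrite big_ord_recr /=; case ph: (p h.+1); last first.
  rewrite addn0; apply: leq_sum => y _.
  by have := pz y (ltn_ord y); case: (p y) => // ->.
have gh' : g <= h.
  by move: gh; rewrite leq_eqVlt => /orP[/eqP E|//]; rewrite E ph in pg.
rewrite [X in _ <= X]big_ord_recr /= (pz1 h) // leq_add2r.
by apply: IH => // y yh; [apply: pz|apply: pz1]; rewrite ltnW.
Qed.

Lemma sum_widen (p : pred nat) h N : h <= N -> (forall y, h <= y -> ~~ p y) ->
  \sum_(y < N) p y = \sum_(y < h) p y.
Proof.
move=> + p0; elim: N => [|N IH]; first by rewrite leqn0 => /eqP->.
rewrite leq_eqVlt => /orP[/eqP->//|hN].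
by rewrite big_ord_recr /= IH // (negPf (p0 N _)) ?addn0.
Qed.

(** * Separated sets in the grid and the lower bound *)

Section Separation.
Variable n : nat.
Implicit Types (S X Y : {set tgrid n}) (c y : nat).

Definition tmem S c y : bool := [exists v in S, (vx v == c) && (vy v == y)].

Definition col S c : nat := \sum_(y < n.+1) tmem S c y.

Lemma tmemP S c y :
  reflect (exists2 v, v \in S & vx v = c /\ vy v = y) (tmem S c y).
Proof.
apply: (iffP existsP) => [[v /and3P[vS /eqP vc /eqP vy]]|[v vS [vc vy]]].
  by exists v.
by exists v; rewrite vS vc vy !eqxx.
Qed.

Lemma tmem_vxy S v : tmem S (vx v) (vy v) = (v \in S).
Proof.
apply/tmemP/idP => [[u uS [ux uy]]|vS]; first by rewrite -(vxy_inj ux uy).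
by exists v.
Qed.

Lemma tmem_le S c y : tmem S c y -> c + y <= n.
Proof. by case/tmemP=> v _ [<- <-]; apply: vxy_le. Qed.

Lemma tmem_out S c y : n < c + y -> tmem S c y = false.
Proof. by rewrite ltnNge => cy; apply: contraNF cy; apply: tmem_le. Qed.

Lemma tmemC S c y : c + y <= n -> tmem (~: S) c y = ~~ tmem S c y.
Proof.
move=> cy; rewrite -[c]/(vx (vtx cy)) -[y]/(vy (vtx cy)) !tmem_vxy.
by rewrite inE.
Qed.

Lemma card_col S : #|S| = \sum_(c < n.+1) col S c.
Proof.
rewrite -(card_imset _ val_inj) -sum1_card big_mkcond /=.
rewrite (eq_bigr (fun p : 'I_n.+1 * 'I_n.+1 => tmem S p.1 p.2 : nat)) => [|p _].
  by rewrite -(pair_big xpredT xpredT (fun c y : 'I_n.+1 => tmem S c y : nat)).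
congr (nat_of_bool _); apply/imsetP/tmemP => -[v vS E]; exists v => //.
  by rewrite E.
case: p E => a b [/= ea eb]; rewrite [RHS]surjective_pairing.
by congr pair; apply/val_inj.
Qed.

Lemma col_widen S c : c <= n -> col S c = \sum_(y < (n - c).+1) tmem S c y.
Proof.
move=> cn; apply: sum_widen => [|y]; first by rewrite ltnS leq_subr.
by move=> ny; apply/negP=> /tmem_le; lia.
Qed.

Lemma col_out S c : n < c -> col S c = 0.
Proof.
move=> nc; rewrite /col big1 // => y _.
by case E: tmem => //; have := tmem_le E; lia.
Qed.

Lemma colT c : c <= n -> col setT c = n.+1 - c.
Proof.
move=> cn; rewrite col_widen // (eq_bigr (fun=> 1)) => [|y _].
  by rewrite sum1_card card_ord subSn.
have cy : c + y <= n by have := ltn_ord y; lia.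
by rewrite -[c]/(vx (vtx cy)) -[_ y]/(vy (vtx cy)) tmem_vxy inE.
Qed.

Lemma card_tgrid : #|tgrid n| = 'C(n.+2, 2).
Proof.
rewrite -cardsT card_col (eq_bigr (fun c : 'I_n.+1 => n.+1 - c)) => [|c _]; last first.
  by rewrite colT // -ltnS.
elim: n => [|N IH]; first by rewrite big_ord1.
rewrite big_ord_recl /= subn0.
by rewrite binS bin1 -IH addnC.
Qed.

Definition separated X Y :=
  [disjoint X & Y] /\ forall u v, u \in X -> v \in Y -> ~~ adj u v.

Lemma separated_sym X Y : separated X Y -> separated Y X.
Proof.
move=> [dXY nXY]; split=> [|u v uY vX]; first by rewrite disjoint_sym.
by rewrite adj_sym nXY.
Qed.

Lemma separated_col X Y c : separated X Y ->
  col (~: X) c = col Y c + col (~: (X :|: Y)) c.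
Proof.
move=> [dXY _]; rewrite /col -big_split /=; apply: eq_bigr => y _.
have [cy|cy] := leqP (c + y) n; last first.
  by rewrite !tmem_out.
rewrite -[c]/(vx (vtx cy)) -[nat_of_ord y]/(vy (vtx cy)) !tmem_vxy !inE.
case vX: (vtx cy \in X) => /=; first by rewrite (disjointFr dXY vX).
by case: (vtx cy \in Y).
Qed.

Lemma separated_nbr X Y c y c' y' : separated X Y -> tmem Y c y -> c' + y' <= n ->
  [|| (c' == c.+1) && (y' == y), (c' == c) && (y' == y.+1),
      (c == c'.+1) && (y' == y.+1), (c == c'.+1) && (y == y'),
      (c == c') && (y == y'.+1) | (c' == c.+1) && (y == y'.+1)] ->
  tmem (~: X) c' y'.
Proof.
move=> [dXY nXY] /tmemP[v vY [vc vy]] cy near; rewrite tmemC //.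
apply/negP=> /tmemP[u uX [uc uy]]; have := nXY u v uX vY.
by rewrite adj_sym tgrid_adjE uc uy vc vy near.
Qed.

(** A cell of column [c.+1] has two neighbours in column [c], at its own height and one higher. *)
Lemma col_sepS X Y c : separated X Y ->
  col Y c.+1 = 0 \/ col Y c.+1 < col Y c + col (~: (X :|: Y)) c.
Proof.
move=> sXY; rewrite -separated_col // /col.
rewrite (@sum_widen (tmem Y c.+1) n) //; last first.
  by move=> y ny; apply/negP=> /tmem_le; lia.
apply: sum_shift_up => y _ Yy; have cy := tmem_le Yy.
by apply/andP; split; apply: (separated_nbr sXY Yy); lia.
Qed.

(** Column [c.+1] is one cell shorter, but a separator cell in column [c] is the gap that
    [sum_shift_down] asks for. *)
Lemma col_sep_le X Y c : separated X Y -> 0 < col (~: (X :|: Y)) c ->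
  col Y c <= col Y c.+1 + col (~: (X :|: Y)) c.+1.
Proof.
move=> sXY f_gt0; have cn : c <= n.
  by rewrite leqNgt; apply: contraTN f_gt0 => /col_out->.
have [g Fg] : exists g, tmem (~: (X :|: Y)) c g.
  apply: contrapT => noF; move: f_gt0; rewrite /col big1 // => y _.
  by case E: tmem => //; case: noF; exists y.
rewrite -separated_col // col_widen // /col.
rewrite (@sum_widen (tmem (~: X) c.+1) (n - c)); last 2 first.
- by lia.
- by move=> y ny; apply/negP=> /tmem_le; lia.
have cg := tmem_le Fg; apply: (@sum_shift_down _ _ _ g); first by lia.
- move: Fg; rewrite tmemC //; apply: contraNN => /tmemP[v vY vE].
  by apply/tmemP; exists v; rewrite // inE vY orbT.
- by move=> y yn Yy; apply: (separated_nbr sXY Yy); lia.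
- by move=> y yn Yy; apply: (separated_nbr sXY Yy); lia.
Qed.

(** A column is a path, so it cannot pass from [X] to [Y] without meeting the separator. *)
Lemma col_sep_full X Y c : separated X Y -> col (~: (X :|: Y)) c = 0 ->
  col X c = 0 \/ col Y c = 0.
Proof.
move=> sXY f0; have [cn|nc] := leqP c n; last by left; apply: col_out.
have XY y : c + y <= n -> tmem X c y = ~~ tmem Y c y.
  move=> cy; have /eqP := f0; rewrite sum_nat_eq0 => /forallP.
  have yn : y < n.+1 by lia.
  move=> /(_ (Ordinal yn)); rewrite implyTb eqb0 /= tmemC // negbK => /tmemP[v + [vc vy]].
  rewrite inE -vc -vy !tmem_vxy.
  by case vX: (v \in X) => //=; [rewrite (disjointFr sXY.1 vX)|move=> ->].
have const y : c + y <= n -> tmem X c y = tmem X c 0.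
  elim: y => [//|y IH] cy; have cy' : c + y <= n by lia.
  rewrite -IH //; case Xy: (tmem X c y).
    have := @separated_nbr Y X c y c y.+1 (separated_sym sXY) Xy cy.
    by rewrite tmemC // XY //; apply; lia.
  move: Xy; rewrite XY // => /negbFE Yy.
  have := @separated_nbr X Y c y c y.+1 sXY Yy cy.
  by rewrite tmemC // => H; apply/negbTE/H; lia.
case X0: (tmem X c 0); [right|left]; rewrite col_widen // big1 // => y _.
  have cy : c + y <= n by have := ltn_ord y; lia.
  by have := const y cy; rewrite X0 XY //; case: tmem.
have cy : c + y <= n by have := ltn_ord y; lia.
by rewrite const // X0.
Qed.

Lemma card_separated_col X Y c0 : separated X Y -> c0 <= n.+1 ->
  col Y c0 = 0 -> col (~: (X :|: Y)) c0 = 0 ->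
  (forall c, c < c0 -> 0 < col (~: (X :|: Y)) c) ->
  #|Y| <= 'C(#|~: (X :|: Y)|, 2).
Proof.
move=> sXY c0n y0 f0 f_gt0; rewrite !card_col.
set y := col Y; set f := col _.
have split_sum (g : nat -> nat) : \sum_(c < n.+1) g c =
    \sum_(c < c0) g c + \sum_(c < n.+1 - c0) g (c0 + c).
  transitivity (\sum_(c < c0 + (n.+1 - c0)) g c); first by rewrite subnKC.
  by rewrite big_split_ord.
rewrite !split_sum bin2D.
have before : \sum_(c < c0) y c <= 'C(\sum_(c < c0) f c, 2).
  by apply: sum_before => // c cc0; apply: col_sep_le => //; apply: f_gt0.
(* [sum_after] also counts column [n.+1], whose summand is dropped afterwards. *)
have : \sum_(c < (n.+1 - c0).+1) y (c0 + c)
    <= 'C(\sum_(c < n.+1 - c0) f (c0 + c), 2).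
  apply: (@sum_after (fun c => y (c0 + c)) (fun c => f (c0 + c))).
    by rewrite addn0.
  by move=> c _; rewrite addnS; apply: col_sepS.
rewrite big_ord_recr /= => /(leq_trans (leq_addr _ _)) after.
exact: leq_trans (leq_add before after) (leq_addr _ _).
Qed.

Lemma separated_isoperimetry X Y : separated X Y ->
  #|X| <= 'C(#|~: (X :|: Y)|, 2) \/ #|Y| <= 'C(#|~: (X :|: Y)|, 2).
Proof.
move=> sXY; have exc : exists c, col (~: (X :|: Y)) c == 0.
  (* Column [n.+1] lies outside the grid, so a first free column exists even if the separator meets
     every column. *)
  by exists n.+1; rewrite col_out.
case: (ex_minnP exc) => c0 /eqP f0 c0_min.
have c0n : c0 <= n.+1 by apply: c0_min; rewrite col_out.
have f_gt0 c : c < c0 -> 0 < col (~: (X :|: Y)) c.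
  by move=> cc0; rewrite lt0n; apply: contraL cc0 => /c0_min; rewrite -leqNgt.
have [x0|y0] := col_sep_full sXY f0; [left|right].
  rewrite setUC in f0 f_gt0 *.
  by apply: card_separated_col f_gt0 => //; apply: separated_sym.
exact: card_separated_col f_gt0.
Qed.

Lemma tgrid_not_searchable k : 0 < n -> k ^ 2 * 2 <= n ^ 2 -> ~ searchable (tgrid n) k.
Proof.
move=> n_gt0 kn /searchableP[T [S [Sk ST]]].
have bin2E p : 'C(p.+1, 2) * 2 = p.+1 * p.
  by elim: p => [|p IH] //; rewrite binS bin1 mulnDl IH; lia.
suff bound t : #|~: dirty S t| <= 'C(k.+1, 2).
  have := bound T; rewrite ST setC0 cardsT card_tgrid.
  have := bin2E k; have := bin2E n.+1; nia.
elim: t => [|t IH]; first by rewrite /= setCT cards0.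
pose Y := dirty S t :\: S t; pose X := ~: nbhd Y.
have sXY : separated X Y.
  have subY : {subset Y <= nbhd Y}.
    by move=> v vY; rewrite inE; apply/existsP; exists v; rewrite vY eqxx.
  split=> [|u v]; first by rewrite disjoints_subset setCS; apply/subsetP.
  rewrite [u \in X]inE inE => /existsPn/(_ v) + vY.
  rewrite vY andTb negb_or => /andP[_].
  by rewrite adj_sym.
rewrite -[dirty S t.+1]/(nbhd Y) -/X; set b := #|~: (X :|: Y)|.
have cardXY : #|X| + #|Y| + b = 'C(n.+2, 2).
  rewrite -card_tgrid -(cardsC (X :|: Y)) cardsU.
  by have := sXY.1; rewrite -setI_eq0 => /eqP->; rewrite cards0 subn0.
have cardY : 'C(n.+2, 2) <= 'C(k.+1, 2) + k + #|Y|.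
  rewrite -card_tgrid -(cardsC Y) addnC leq_add2r /Y setCD setUC.
  rewrite (leq_trans (leq_card_setU _ _)) // addnC leq_add //.
(* If [k <= b], the boundary takes back at least the [k] cells that one inspection can clean. *)
have [kb|bk] := leqP k b; first by lia.
have bbk : 'C(b, 2) <= 'C(k.-1, 2) by apply: leq_bin2; lia.
have [Xb|Yb] := separated_isoperimetry sXY.
  by apply: (leq_trans Xb); apply: leq_bin2; lia.
(* Now ['C(n.+2, 2) <= 'C(k.+1, 2) + k + 'C(k.-1, 2) = k ^ 2 + 1], whereas
   ['C(n.+2, 2) = (n ^ 2 + 3 n) / 2 + 1]. *)
exfalso; have := leq_trans Yb bbk; move: cardY.
have := bin2E k; have := bin2E n.+1.
have [k0|k1] := posnP k.-1; last first.
  by have := bin2E k.-2; rewrite prednK //; nia.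
have -> : k = 1 by lia.
by rewrite /= bin0n; nia.
Qed.

End Separation.

(** * The sweeping strategy and the upper bound *)

Lemma radix_inj w a b x y : a * w + x = b * w + y -> x < w -> y < w ->
  a = b /\ x = y.
Proof.
move=> E xw yw; have := congr1 (edivn^~ w) E.
by rewrite !edivn_eq // => -[-> ->].
Qed.

Section Strategy.
Variable n : nat.

Definition region (P : nat -> nat -> bool) : {set tgrid n} :=
  [set v | P (vx v) (vy v)].

Lemma regionS (P Q : nat -> nat -> bool) : (forall x y, x + y <= n -> P x y -> Q x y) ->
  region P \subset region Q.
Proof. by move=> PQ; apply/subsetP=> v; rewrite !inE; apply/PQ/vxy_le. Qed.

Lemma tgrid_near (u v : tgrid n) : (u == v) || adj u v ->
  [|| (vx u == vx v) && (vy u == vy v),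
      (vx v == (vx u).+1) && (vy v == vy u), (vx v == vx u) && (vy v == (vy u).+1),
      (vx u == (vx v).+1) && (vy v == (vy u).+1),
      (vx u == (vx v).+1) && (vy u == vy v), (vx u == vx v) && (vy u == (vy v).+1)
    | (vx v == (vx u).+1) && (vy u == (vy v).+1)].
Proof. by rewrite tgrid_adjE => /orP[/eqP->|->]; rewrite ?eqxx ?orbT. Qed.

Definition corner s i x y := (x + y < s) || (x + y == s) && (x < i).

(** At most [s + 1 - i] cells remain on diagonal [s], and [i + 2] cells of diagonal [s + 1] shield
    the new cell: [s + 3] in all. *)
Lemma cleanable_corner_step k s i : s.+3 <= k -> i <= s ->
  cleanable k (region (corner s i)) -> cleanable k (region (corner s i.+1)).
Proof.
move=> ks si cP; rewrite /corner.
apply: (tgrid_step (B := fun x y => (x + y <= s) || (x + y == s.+1) && (x <= i.+1))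
  (f := fun x y => (x + y - s) * s.+1 + x) (lo := i) cP).
- by move=> u v + /tgrid_near; lia.
- move=> v; rewrite /corner => vB vP.
  have [E|E] : vx v + vy v - s = 0 \/ vx v + vy v - s = 1 by lia.
    by rewrite E; lia.
  by rewrite E; lia.
- move=> u v; rewrite /corner => uB uP vB vP.
  have [E|E] : vx v + vy v - s = 0 \/ vx v + vy v - s = 1 by lia.
    by have [E'|E'] : vx u + vy u - s = 0 \/ vx u + vy u - s = 1; rewrite ?E ?E'; lia.
  by have [E'|E'] : vx u + vy u - s = 0 \/ vx u + vy u - s = 1; rewrite ?E ?E'; lia.
Qed.

Lemma cleanable_corner k s : s.+2 <= k -> cleanable k (region (corner s 0)).
Proof.
elim: s => [|s IH] ks.
  apply: cleanableS (cleanable0 _ k); apply/subsetP=> v.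
  by rewrite !inE /corner; lia.
have cs i : i <= s.+1 -> cleanable k (region (corner s i)).
  elim: i => [|i IHi] si; first by apply: IH; lia.
  by apply: cleanable_corner_step; [|lia|apply: IHi; lia].
apply: cleanableS (cs s.+1 (leqnn _)); apply: regionS => x y _.
by rewrite /corner; lia.
Qed.

Definition strip h i x y := (y < h) || (y == h) && (x < i).

(** At most [n - h + 1 - i] cells remain in row [h], and [i + 1] cells of row [h + 1] shield the
    clean part: [n - h + 2] in all. *)
Lemma cleanable_strip_step k h i : n.+2 <= k + h -> i <= n - h ->
  cleanable k (region (strip h i)) -> cleanable k (region (strip h i.+1)).
Proof.
move=> kh hi cP; rewrite /strip.
apply: (tgrid_step (B := fun x y => (y <= h) || (y == h.+1) && (x <= i))
  (f := fun x y => (y - h) * (n.+1 - h) + x) (lo := i) cP).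
- by move=> u v + /tgrid_near; lia.
- move=> v; have := vxy_le v; rewrite /strip => vn vB vP.
  by have [E|E] : vy v - h = 0 \/ vy v - h = 1; rewrite ?E; lia.
- move=> u v; have := vxy_le v; have := vxy_le u.
  rewrite /strip => un vn uB uP vB vP.
  have [E|E] : vy v - h = 0 \/ vy v - h = 1 by lia.
    by have [E'|E'] : vy u - h = 0 \/ vy u - h = 1; rewrite ?E ?E'; lia.
  by have [E'|E'] : vy u - h = 0 \/ vy u - h = 1; rewrite ?E ?E'; lia.
Qed.

Lemma strip_searchable k m : n.+2 <= k + m ->
  cleanable k (region (strip m 0)) -> searchable (tgrid n) k.
Proof.
move=> km cm; have ch d : cleanable k (region (strip (m + d) 0)).
  elim: d => [|d IH]; first by rewrite addn0.
  have cs i : i <= (n - (m + d)).+1 -> cleanable k (region (strip (m + d) i)).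
    elim: i => [|i IHi] si; first exact: IH.
    by apply: cleanable_strip_step; [lia|lia|apply: IHi; lia].
  apply: cleanableS (cs _ (leqnn _)); apply: regionS => x y xy.
  by rewrite /strip; lia.
apply: cleanableT; apply: cleanableS (ch n.+1).
by apply/subsetP=> v _; rewrite inE /strip; have := vxy_le v; lia.
Qed.

(* The corner retreats by one diagonal per inspection, which frees enough
   inspections to complete rows above the bottom side. *)
Definition tilted s h i x y :=
  [|| x + y < s, y < h | (y == h) && (x + y < s + i)].

(** Beyond diagonal [s] a row has at most [w = n - s] cells. Rows [h] to [h'] are inspected except
    the [i] clean cells of row [h], together with [i'] shielding cells of row [h'.+1]; the
    retreating front costs nothing. *)
Lemma cleanable_tilted_step k s h i h' i' : h <= h' -> i <= n - s ->
  (h' - h).+1 * (n - s) + i' <= k + i ->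
  cleanable k (region (tilted s.+1 h i)) -> cleanable k (region (tilted s h' i')).
Proof.
move=> hh' iw cost cP; rewrite /tilted; set w := n - s in iw cost.
apply: (tgrid_step (B := fun x y => [|| x + y <= s, y <= h'
      | (y == h'.+1) && (x + y <= s + i')])
  (f := fun x y => (y - h) * w + (x + y - s.+1)) (lo := i) cP).
- by move=> u v + /tgrid_near; lia.
- move=> v; have := vxy_le v; rewrite /tilted => vn vB vP.
  have ow : vx v + vy v - s.+1 < w by rewrite /w; lia.
  apply/andP; split.
    have [E|E] : vy v = h \/ h < vy v by lia.
      by rewrite E; lia.
    have : w <= (vy v - h) * w by rewrite leq_pmull // subn_gt0.
    by lia.
  have [E|E] : vy v = h'.+1 \/ vy v <= h' by lia.
    by rewrite E subSn //; lia.
  have : (vy v - h) * w <= (h' - h) * w by rewrite leq_mul2r leq_sub2r ?orbT.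
  by lia.
- move=> u v; have := vxy_le v; have := vxy_le u.
  rewrite /tilted => un vn uB uP vB vP /radix_inj[]; rewrite /w; lia.
Qed.

End Strategy.

(* With [s = m + 1 + t], step [t] gains at least [(3 m + 1 - s) / s] rows, where
   [h + i / w] counts the completed rows.  The invariant sums this over [t] after
   replacing [1 / s] by its tangent at the midpoint [a / 2] of the range of [s]. *)
Lemma greedy_rows m h i h' i' t : let w := m + t.+1 in let a := m * 4 + 1 in
  t < m * 2 -> i' < w -> h' * w + i' = h * w + i + (m * 2 + 1 - t) ->
  (m * 3 + 1) * 2 * t * (m * 6 + 1 - t) * w <= a ^ 2 * (h * w + i + t * w) ->
  (m * 3 + 1) * 2 * t.+1 * (m * 6 + 1 - t.+1) * w.+1
    <= a ^ 2 * (h' * w.+1 + i' + t.+1 * w.+1).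
Proof.
move=> w a tm i'w hi inv.
have w0 : 0 < w by rewrite /w addnS.
rewrite -(leq_pmul2r w0).
have wa : w <= a by rewrite /w /a; lia.
(* This is [1 / w >= 4 (a - w) / a ^ 2], by the inequality of means. *)
have tangent : (a - w) * 4 * w <= a ^ 2.
  by have [+ _] := nat_AGM2 (a - w) w; rewrite subnK // [4 * _]mulnC mulnAC.
(* The term [a ^ 2 * i'] is the loss from measuring the incomplete row against width [w.+1]; the
   surplus of [m * 3 + 2] over [m * 3 + 1] absorbs it. *)
have E1 : a ^ 2 * (h' * w.+1 + i' + t.+1 * w.+1) * w + a ^ 2 * i'
   = a ^ 2 * (h * w + i + t * w) * w.+1 + a ^ 2 * (m * 3 + 2) * w.+1.
  have -> : m * 3 + 2 = m * 2 + 1 - t + w by rewrite /w; lia.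
  transitivity (a ^ 2 * (w.+1 * (h' * w + i')) + a ^ 2 * (t.+1 * w.+1 * w)).
    by lia.
  by rewrite hi; lia.
(* The polynomial [2 t (6 m + 1 - t)] is the sum of the tangent values [4 (a - w)] over the first
   [t] steps. *)
have E2 : (m * 3 + 1) * 2 * t.+1 * (m * 6 + 1 - t.+1) =
  (m * 3 + 1) * 2 * t * (m * 6 + 1 - t) + (m * 3 + 1) * ((a - w) * 4).
  have [q q6] : exists q, m * 6 = q + t by exists (m * 6 - t); lia.
  have -> : m * 6 + 1 - t.+1 = q by lia.
  have -> : m * 6 + 1 - t = q.+1 by lia.
  have -> : (a - w) * 4 = (q - t) * 2 by rewrite /a /w; lia.
  have tq : t <= q by lia.
  have /subnKC <- := tq; rewrite addKn; lia.
have T' : (m * 3 + 1) * ((a - w) * 4 * w) * w.+1 <= (m * 3 + 1) * a ^ 2 * w.+1.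
  by rewrite leq_mul2r leq_mul2l tangent !orbT.
have I' := leq_mul inv (leqnn w.+1).
have i'a : a ^ 2 * i' <= a ^ 2 * w.+1 by rewrite leq_mul2l; apply/orP; right; lia.
rewrite E2.
move: (a ^ 2) ((m * 3 + 1) * 2 * t * (m * 6 + 1 - t)) ((a - w) * 4) (h * w + i + t * w)
  (h' * w.+1 + i' + t.+1 * w.+1) E1 T' I' i'a => A g D K L E1 T' I' i'a.
move: (m * 3) E1 T' => c E1 T'; clear -E1 T' I' i'a.
lia.
Qed.

Lemma tgrid_searchable n m : m * 4 <= n -> searchable (tgrid n) (n - m).+2.
Proof.
move=> mn; set j := n - m.
have [h [i [i_lt inv ch]]] : exists h i, [/\ i < m + (m * 2).+1,
    (m * 3 + 1) * 2 * (m * 2) * (m * 6 + 1 - m * 2) * (m + (m * 2).+1)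
      <= (m * 4 + 1) ^ 2 * (h * (m + (m * 2).+1) + i + m * 2 * (m + (m * 2).+1))
    & cleanable j.+2 (@region n (tilted (j - m * 2) h i))].
  (* After [t] moves the front is at diagonal [j - t], and [m + t.+1] bounds the number of cells of
     a row from there on. *)
  suff: forall t, t <= m * 2 -> exists h i, [/\ i < m + t.+1,
    (m * 3 + 1) * 2 * t * (m * 6 + 1 - t) * (m + t.+1)
      <= (m * 4 + 1) ^ 2 * (h * (m + t.+1) + i + t * (m + t.+1))
    & cleanable j.+2 (@region n (tilted (j - t) h i))] by exact.
  elim=> [|t IH] tm.
    exists 0, 0; split; [by lia|by lia|].
    apply: cleanableS (cleanable_corner n (leqnn j.+2)).
    by apply: regionS => x y _; rewrite /tilted /corner; lia.
  have [h [i [i_lt inv ch]]] := IH (ltnW tm).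
  (* Of the [j.+2] inspections, [w] maintain the front of the rows; since [4 m <= n], at least
     [2 m + 1 - t] are left for progress. *)
  pose w := m + t.+1; pose N := i + (m * 2 + 1 - t).
  have w_gt0 : 0 < w by rewrite /w addnS.
  have Ndiv : (h + N %/ w) * w + N %% w = h * w + i + (m * 2 + 1 - t).
    by rewrite mulnDl -addnA -divn_eq addnA.
  have Nmod : N %% w < w by rewrite ltn_mod.
  exists (h + N %/ w), (N %% w); split.
  - by rewrite addnS ltnS ltnW.
  - by have := greedy_rows tm Nmod Ndiv inv; rewrite -addnS.
  have -> : j - t.+1 = (j - t).-1 by lia.
  apply: (@cleanable_tilted_step _ _ _ h i); first exact: leq_addr.
  - by rewrite /j; lia.
  - have -> : n - (j - t).-1 = w by rewrite /w /j; lia.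
    by rewrite addKn mulSn -addnA -divn_eq /N /w /j; lia.
  - by have -> : (j - t).-1.+1 = j - t by rewrite /j; lia.
(* Otherwise [h * w + i < m * w], and the invariant at [t = 2 m] would give
   [4 m (3 m + 1) w < 3 m (4 m + 1) w]. *)
have mh : m <= h.
  rewrite leqNgt; apply/negP=> hm.
  set w := m + _ in i_lt inv.
  have w_gt0 : 0 < w by rewrite /w addnS.
  have : h * w + i < m * w.
    by apply: (@leq_trans (h.+1 * w)); rewrite ?leq_mul2r ?hm ?orbT // mulSn; lia.
  have E : m * 6 + 1 - m * 2 = m * 4 + 1 by lia.
  move: inv; rewrite E -mulnn => inv lt_m.
  have : (m * 3 + 1) * 2 * (m * 2) * w <= (m * 4 + 1) * (h * w + i + m * 2 * w).
    by rewrite -(@leq_pmul2r (m * 4 + 1)) ?addn1 //; lia.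
  have : (m * 4 + 1) * (h * w + i + m * 2 * w).+1 <= (m * 4 + 1) * (m * w + m * 2 * w).
    by rewrite leq_mul2l; apply/orP; right; lia.
  by lia.
apply: (@strip_searchable _ _ m); first by rewrite /j; lia.
apply: cleanableS ch; apply: regionS => x y _.
by rewrite /strip /tilted; lia.
Qed.

(** * Translation of both bounds to real numbers *)

Local Open Scope ring_scope.

Theorem theorem2 (R : realType) (n : nat) (hn : (0 < n)%N) :
  n%:R / Num.sqrt 2 < (inspection_number (tgrid n))%:R :> R /\
  (inspection_number (tgrid n))%:Z <= Num.ceil (3 * n%:R / 4 : R) + 2.
Proof.
rewrite /inspection_number; case: ex_minnP => k /asboolP sk k_min; split.
  rewrite ltNge; apply/negP => le_k; apply: (tgrid_not_searchable hn _ sk).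
  have s2 : 0 < Num.sqrt 2 :> R by rewrite sqrtr_gt0 ltr0n.
  move: le_k; rewrite ler_pdivlMr // => le_k.
  have : (k%:R * Num.sqrt 2) ^+ 2 <= n%:R ^+ 2 :> R.
    by rewrite ler_pXn2r ?nnegrE ?mulr_ge0 ?sqrtr_ge0 ?ler0n.
  by rewrite exprMn sqr_sqrtr ?ler0n // -!natrX -natrM ler_nat.
have /asboolP/k_min le_k := tgrid_searchable (leq_divM n 4).
(* By integrality, [n - n %/ 4 - 1 < 3 n / 4] bounds [n - n %/ 4] by the ceiling. *)
have : (n - n %/ 4)%N%:Z - 1 < Num.ceil (3 * n%:R / 4 : R).
  rewrite ceil_gt_int ltr_pdivlMr ?ltr0n // intrB -pmulrn.
  have : (((n - n %/ 4) * 4)%N < 3 * n + 4)%N by lia.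
  by rewrite -(ltr_nat R) natrD !natrM; lra.
by lia.
Qed.
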